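(* Let $n \geq 2$ and let $z_1,\dots,z_n$ be the standard coordinates on $\mathbb{C}^n$. Consider the polynomial vector fields $$U = \frac{\partial}{\partial z_n},$$ $$V' = \frac{\partial}{\partial z_n} + \sum_{k=2}^{n} \Big(\prod_{j=k+1}^{n} z_j^2\Big) z_k^5 \,\frac{\partial}{\partial z_{k-1}} = \frac{\partial}{\partial z_n} + z_n^5 \frac{\partial}{\partial z_{n-1}} + z_n^2 z_{n-1}^5 \frac{\partial}{\partial z_{n-2}} + \dots + z_n^2 z_{n-1}^2\cdots z_3^2 z_2^5 \frac{\partial}{\partial z_1},$$ $$V'' = \frac{\partial}{\partial z_1} + \sum_{k=2}^{n} \Big(\prod_{j=1}^{k-2} z_j^2\Big) z_{k-1}^5 \,\frac{\partial}{\partial z_k} = \frac{\partial}{\partial z_1} + z_1^5 \frac{\partial}{\partial z_2} + z_1^2 z_2^5 \frac{\partial}{\partial z_3} + \dots + z_1^2 z_2^2\cdots z_{n-2}^2 z_{n-1}^5 \frac{\partial}{\partial z_n}.$$ Then $U$, $V'$ and $V''$ are complete, and they generate the complex Lie algebra generated by all complete polynomial vector fields on $\mathbb{C}^n$ with polynomial flow; that is, the smallest complex Lie algebra of vector fields containing $U$, $V'$, $V''$ equals the complex Lie algebra generated by all complete polynomial vector fields on $\mathbb{C}^n$ with polynomial flow.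
   Context: A polynomial vector field on $\mathbb{C}^n$ is a vector field $\sum_{i=1}^n f_i \frac{\partial}{\partial z_i}$ with $f_i \in \mathbb{C}[z_1,\dots,z_n]$; the bracket is the usual commutator of vector fields. A holomorphic vector field is called complete (or completely integrable) if its flow map exists for all complex times. A complete polynomial vector field has polynomial flow if its flow is a unipotent one-parameter subgroup, i.e. an algebraic action of the additive group $\mathbb{C}_+$ on $\mathbb{C}^n$: the flow map $\mathbb{C}\times\mathbb{C}^n \to \mathbb{C}^n$, $(t,z) \mapsto \varphi_t(z)$, is polynomial in $(t,z)$. Empty products equal $1$. *)

(* Defs.v *)
From HB Require Import structures.
From mathcomp Require Import all_boot all_order all_algebra.
From mathcomp Require Import complex.
(* The notations of mpoly clash with those of MathComp-Analysis. *)
From mathcomp Require Import -(notations) mpoly.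
From mathcomp Require Import all_classical all_reals all_analysis.

Set Implicit Arguments.
Unset Strict Implicit.
Unset Printing Implicit Defensive.

Import Order.TTheory GRing.Theory Num.Theory numFieldNormedType.Exports.
Local Open Scope classical_set_scope.
Local Open Scope ring_scope.

(* Typed in numClosedFieldType so that the topology and the normed module
   structure given by the modulus are inferred; differentiation of functions
   on [CC R] is then complex differentiation. *)
Definition CC (R : realType) : numClosedFieldType := R[i].

(* [V : polyvf R n] stands for the field \sum_i V i d/dz_i on C^n.
   Coordinates are numbered from 0: z_0, ..., z_(n-1). *)
Notation polyvf R n := {ffun 'I_n -> mpoly n (CC R)}.

Section VectorFields.
Variables (R : realType) (n : nat).
Implicit Types (V W : polyvf R n) (p : mpoly n (CC R)).

Definition zvar (i : 'I_n) : mpoly n (CC R) := mpolyX (CC R) (mnm1 i).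

(* d/dz_k; the index is a natural number, and the field is 0 if n <= k. *)
Definition dz (k : nat) : polyvf R n := [ffun i : 'I_n => (k == i)%:R].

Definition vfmul p V : polyvf R n := [ffun i => p * V i].

Definition vfapply V p : mpoly n (CC R) := \sum_(j < n) V j * mderiv j p.

Definition lie_bracket V W : polyvf R n :=
  [ffun i => vfapply V (W i) - vfapply W (V i)].

Definition lie_subalgebra (L : set (polyvf R n)) : Prop :=
  [/\ L 0,
      forall V W, L V -> L W -> L (V + W),
      forall (a : CC R) V, L V -> L (a *: V)
    & forall V W, L V -> L W -> L (lie_bracket V W)].

Definition lie_generated (S : set (polyvf R n)) : set (polyvf R n) :=
  \bigcap_(L in [set L | lie_subalgebra L /\ S `<=` L]) L.

Definition is_flow V (phi : CC R -> ('I_n -> CC R) -> 'I_n -> CC R) : Prop :=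
  (forall z, phi 0 z = z) /\
  forall (t : CC R) z i,
    is_derive t (1 : CC R) (fun s : CC R => phi s z i)
      (meval (phi t z) (V i)).

Definition complete V : Prop := exists phi, is_flow V phi.

(* In the polynomials P i, variable 0 is the time and variable k.+1 is z_k. *)
Definition polynomial_flow V : Prop :=
  exists2 phi, is_flow V phi &
    exists P : 'I_n -> mpoly n.+1 (CC R), forall t z i,
      phi t z i = meval (fun j => oapp z t (unlift ord0 j)) (P i).

Definition Uvf : polyvf R n := dz n.-1.

Definition V'vf : polyvf R n :=
  dz n.-1 +
  \sum_(k < n | (0 < k)%N)
    vfmul ((\prod_(j < n | (k < j)%N) zvar j ^+ 2) * zvar k ^+ 5) (dz k.-1).

(* Here k is the index of the variable raised to the fifth power. *)
Definition V''vf : polyvf R n :=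
  dz 0 +
  \sum_(k < n | (k.+1 < n)%N)
    vfmul ((\prod_(j < n | (j < k)%N) zvar j ^+ 2) * zvar k ^+ 5) (dz k.+1).

End VectorFields.

(* Main.v *)
(* Both sides equal the Lie algebra of divergence-free polynomial fields.

   A field V with polynomial flow P is divergence-free: the Jacobian determinant
   J of P in z satisfies d_t J = (div V)(P) J, and d_t strictly lowers the degree
   of the nonzero polynomial J, so (div V)(P) = 0, and t = 0 gives div V = 0.
   The fields U, V', V'' are triangular, so integrating one coordinate after the
   other gives polynomial flows.

   Conversely, let L be a Lie algebra containing U, V', V''.  Bracketing V'
   repeatedly with U = d_n, the term z_n^5 d_(n-1) yields z_n^2 d_(n-1),
   z_n d_(n-1) and d_(n-1), while the second derivative of the factor z_n^2 frees
   the rest of V', up to a term killed by d_(n-1), so the process continues.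
   Together with V'' this gives all z_i d_j and z_i^2 d_j, then all z_i^a d_j,
   then all p d_j with d_j p = 0, and with them all
   (d_j f) d_i - (d_i f) d_j.  A divergence-free V is g d_1 plus such fields, with
   d_1 g = 0: take for f an antiderivative of V_j in z_1. *)

Require Import Defs.
From mathcomp Require Import all_boot all_order all_algebra all_classical all_reals.
From mathcomp Require Import all_analysis ring zify perm.
From mathcomp Require Import -(notations) mpoly.
Import Order.TTheory GRing.Theory Num.Theory numFieldNormedType.Exports.
Set Implicit Arguments.
Unset Strict Implicit.
Unset Printing Implicit Defensive.
Local Open Scope classical_set_scope.
Local Open Scope ring_scope.

(** * Polynomial calculus *)

Section Mpoly.
Variables (K : comNzRingType) (n : nat).
Implicit Types p q : mpoly n K.

Lemma mpoly_ring_ind (P : mpoly n K -> Prop) :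
  (forall c, P (mpolyC n c)) -> (forall i, P (mpolyX K (mnm1 i))) ->
  (forall p q, P p -> P q -> P (p + q)) ->
  (forall p q, P p -> P q -> P (p * q)) -> forall p, P p.
Proof.
move=> PC PX PD PM; elim/mpolyind => [|c m p _ _ Pp]; first exact: (PC 0).
apply: (PD) => //; rewrite -mul_mpolyC; apply: (PM) => //.
rewrite mpolyXE_id; apply: (big_ind P) => [|p1 p2|i _]; [exact: (PC 1)|exact: PM|].
by elim: (m i) => [|k IH]; rewrite ?expr0 ?exprS; [exact: (PC 1)|exact: PM].
Qed.

Lemma mderiv_mpolyX i j : mderiv i (mpolyX K (mnm1 j)) = (i == j)%:R :> mpoly n K.
Proof.
rewrite mderivX mnm1E eq_sym; case: eqP => [->|_]; last by rewrite scale0r.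
by rewrite -{1}[mnm1 j]add0m addmK mpolyX0 scale1r.
Qed.

(** Both sides are derivations along [phi] that vanish on constants, so it is enough that they agree
    on the variables. Taking [D] to be a partial derivative after a substitution gives the chain
    rule. *)
Lemma derivation_mpolyE (S : comNzRingType) (phi : {rmorphism mpoly n K -> S})
    (D : {additive mpoly n K -> S}) p :
  (forall c, D (mpolyC n c) = 0) ->
  (forall p q, D (p * q) = D p * phi q + phi p * D q) ->
  D p = \sum_(i < n) phi (mderiv i p) * D (mpolyX K (mnm1 i)).
Proof.
move=> DC DM; elim/mpoly_ring_ind: p => [c|j|p q IHp IHq|p q IHp IHq].
- by rewrite DC big1 // => i _; rewrite mderivC raddf0 mul0r.
- rewrite (bigD1 j) //= big1 ?addr0 => [|i /negPf ne_ij].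
    by rewrite mderiv_mpolyX eqxx rmorph1 mul1r.
  by rewrite mderiv_mpolyX ne_ij rmorph0 mul0r.
- by rewrite raddfD IHp IHq -big_split; apply: eq_bigr => i _; rewrite mderivD raddfD mulrDl.
rewrite DM IHp IHq mulr_suml mulr_sumr -big_split; apply: eq_bigr => i _ /=.
by rewrite mderivM rmorphD !rmorphM; ring.
Qed.

End Mpoly.

Lemma mderiv_comp_mpoly (K : comNzRingType) (m n : nat) (P : m.-tuple (mpoly n K))
    (p : mpoly m K) i :
  mderiv i (comp_mpoly P p) =
  \sum_(k < m) comp_mpoly P (mderiv k p) * mderiv i (tnth P k).
Proof.
pose D : {additive mpoly m K -> mpoly n K} := mderiv i \o comp_mpoly P.
rewrite -[LHS]/(D p) (derivation_mpolyE (phi := comp_mpoly P)) => [|c|q r].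
- by apply: eq_bigr => k _ /=; rewrite /comp_mpoly mmapX mmap1U.
- by rewrite /= comp_mpolyC mderivC.
by rewrite /= rmorphM mderivM.
Qed.

(** The second clause selects the antiderivative that vanishes on the hyperplane z_i = 0. When z_i
    is time, this is what secures the initial condition. *)
Lemma antiderivative (K : numFieldType) (n : nat) (i : 'I_n) (p : mpoly n K) :
  exists q, mderiv i q = p /\ forall v, v i = 0 -> meval v q = 0.
Proof.
elim/mpolyind: p => [|c m p _ _ [q [qE q0]]].
  by exists 0; split=> [|v _]; rewrite ?mderiv0 ?meval0.
exists ((c / (m i).+1%:R) *: mpolyX K (mnm_add m (mnm1 i)) + q); split.
  rewrite mderivD mderivZ mderivX qE addmK mnmDE mnm1E eqxx addn1 scalerA.
  by rewrite divfK // pnatr_eq0.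
move=> v v0; rewrite mevalD mevalZ mpolyXD mevalM mevalXU v0 q0 //.
by rewrite mulr0 mulr0 addr0.
Qed.

Lemma is_derive_meval (K : numFieldType) (n : nat) (v : K -> 'I_n -> K) (dv : 'I_n -> K)
    (t : K) (p : mpoly n K) :
  (forall i, is_derive t (1 : K) (fun s => v s i) (dv i)) ->
  is_derive t (1 : K) (fun s => meval (v s) p)
    (\sum_(i < n) meval (v t) (mderiv i p) * dv i).
Proof.
move=> dvP; elim/mpoly_ring_ind: p => [c|j|p q IHp IHq|p q IHp IHq].
- rewrite big1 => [|i _]; last by rewrite mderivC meval0 mul0r.
  rewrite [X in is_derive _ _ X](_ : _ = cst c); first exact: is_derive_cst.
  by apply/funext => s; rewrite mevalC.
- rewrite (bigD1 j) //= big1 => [|i /negPf ne_ij]; last first.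
    by rewrite mderiv_mpolyX ne_ij meval0 mul0r.
  rewrite mderiv_mpolyX eqxx meval1 mul1r addr0.
  rewrite [X in is_derive _ _ X](_ : _ = v^~ j); first exact: dvP.
  by apply/funext => s; rewrite mevalXU.
- have := is_deriveD IHp IHq; rewrite -big_split /=.
  rewrite [X in is_derive _ _ X](_ : _ = fun s => meval (v s) (p + q)); last first.
    by apply/funext => s; rewrite mevalD.
  move=> h; apply: is_derive_eq h _; apply: eq_bigr => i _.
  by rewrite mderivD mevalD mulrDl.
have := is_deriveM IHp IHq.
rewrite [X in is_derive _ _ X](_ : _ = fun s => meval (v s) (p * q)); last first.
  by apply/funext => s; rewrite mevalM.
move=> h; apply: is_derive_eq h _.
rewrite !scaler_sumr -big_split /=; apply: eq_bigr => i _.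
by rewrite mderivM mevalD !mevalM /GRing.scale /=; ring.
Qed.

Lemma is_derive_unique (K : numFieldType) (V W : normedModType K) (f : V -> W) (a v : V)
    (d1 d2 : W) : is_derive a v f d1 -> is_derive a v f d2 -> d1 = d2.
Proof. by move=> [_ <-] [_ <-]. Qed.

Lemma meval_mderiv (K : numFieldType) (n : nat) (p : mpoly n K) (i : 'I_n) (z : 'I_n -> K) :
  is_derive (0 : K) (1 : K) (fun s => meval (fun j => z j + s * (i == j)%:R) p)
    (meval z (mderiv i p)).
Proof.
have h j : is_derive (0 : K) (1 : K) (fun s : K => z j + s * (i == j)%:R) (i == j)%:R.
  have h1 := is_deriveZ (i == j)%:R (is_derive_id (0 : K) (1 : K)).
  have := is_deriveD (is_derive_cst (z j) (0 : K) (1 : K)) h1.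
  rewrite [X in is_derive _ _ X](_ : _ = fun s => z j + s * (i == j)%:R); last first.
    by apply/funext => s; congr (_ + _); exact: mulrC.
  by move=> hd; apply: is_derive_eq hd _; rewrite add0r [LHS]mulr1.
apply: is_derive_eq (is_derive_meval p h) _.
have ez : (fun j => z j + 0 * (i == j)%:R) = z.
  by apply/funext => j; rewrite mul0r addr0.
rewrite ez (bigD1 i) //= eqxx mulr1 big1 ?addr0 // => j /negPf.
by rewrite eq_sym => ->; rewrite mulr0.
Qed.

(** A derivative of a polynomial that vanishes everywhere is a derivative of the zero function along
    a line, so all iterated partial derivatives of [p] vanish at the origin. There the derivative of
    multi-order [m] is the coefficient at [m] times a product of factorials, which is nonzero in
    characteristic 0. *)
Lemma meval_eq0 (K : numFieldType) (n : nat) (p : mpoly n K) :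
  (forall v, meval v p = 0) -> p = 0.
Proof.
move=> p0.
have d0 (q : mpoly n K) i : (forall v, meval v q = 0) -> forall v, meval v (mderiv i q) = 0.
  move=> q0 v; apply: (is_derive_unique (meval_mderiv q i v)).
  rewrite [X in is_derive _ _ X](_ : _ = cst 0); first exact: is_derive_cst.
  by apply/funext => s; rewrite q0.
have {}d0 m v : meval v (mderivm m p) = 0.
  by rewrite mderivm_foldr; elim: flatten v => //= j s IH v; exact: d0.
apply/mpolyP => m; rewrite mcoeff0.
have v0 (q : mpoly n K) : meval (fun=> 0) q = mcoeff (@mnm0 n) q.
  elim/mpoly_ring_ind: q => [c|j|q r IHq IHr|q r IHq IHr].
  - by rewrite mevalC mcoeffC eqxx mulr1.
  - by rewrite mevalXU mcoeffX mnm1_eq0.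
  - by rewrite mevalD mcoeffD IHq IHr.
  by rewrite mevalM IHq IHr rmorphM.
have /eqP := d0 m (fun=> 0); rewrite v0 mcoeff_mderivm mulrn_eq0 addm0 => /orP[|/eqP//].
by rewrite -leqn0 leqNgt prodn_gt0 // => i; rewrite ffact_gt0 leqnn.
Qed.

Lemma derivation_prod (S : comNzRingType) (D : {additive S -> S}) (I : finType) (F : I -> S) :
  (forall x y, D (x * y) = D x * y + x * D y) ->
  D (\prod_i F i) = \sum_i D (F i) * \prod_(j | j != i) F j.
Proof.
move=> DM; have D1 : D 1 = 0.
  by apply: (addrI (D 1)); rewrite addr0 -{3}[1]mulr1 DM mulr1 mul1r.
have gen (r : seq I) : uniq r ->
    D (\prod_(i <- r) F i) = \sum_(i <- r) D (F i) * \prod_(j <- r | j != i) F j.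
  elim: r => [|i r IH] /=; first by rewrite !big_nil.
  case/andP => ir ur; rewrite !big_cons eqxx /= DM IH //; congr (_ * _ + _).
    rewrite big_seq [RHS]big_seq_cond; apply: eq_bigl => j.
    by case: eqP => [->|_]; rewrite ?(negPf ir) ?andbT.
  rewrite mulr_sumr big_seq [RHS]big_seq; apply: eq_bigr => j jr.
  rewrite big_cons; case: eqP => [eij|_]; last by rewrite mulrCA.
  by rewrite eij jr in ir.
exact: gen (index_enum_uniq I).
Qed.

(** By the Leibniz rule, [D] differentiates one row of the determinant at a time. The derivative of
    row [i] is the combination of the rows [k] with coefficients [A i k]. Let [N i k] be [M] with
    row [i] replaced by row [k]: it has two equal rows unless k = i, so only the diagonal of [A]
    contributes. *)
Lemma liouville_det (S : comNzRingType) (D : {additive S -> S}) (n : nat)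
    (A M : 'M[S]_n) :
  (forall x y, D (x * y) = D x * y + x * D y) -> map_mx D M = A *m M ->
  D (\det M) = \tr A * \det M.
Proof.
move=> DM AM.
have DN (b : bool) x : D ((-1) ^+ b * x) = (-1) ^+ b * D x.
  by rewrite !mulr_sign; case: b => //; rewrite raddfN.
pose N i k : 'M[S]_n := \matrix_(i', j) (if i' == i then M k j else M i' j).
have detN i k : \det (N i k) = \det M *+ (i == k).
  have [<-|ne_ik] := eqVneq i k.
    by congr (\det _); apply/matrixP => i' j; rewrite mxE; case: eqP => [->|].
  apply: (determinant_alternate ne_ik) => j.
  by rewrite !mxE eqxx eq_sym (negPf ne_ik).
have -> : D (\det M) = \sum_i \sum_k A i k * \det (N i k).
  rewrite /determinant raddf_sum /=.
  under eq_bigr do rewrite DN derivation_prod // mulr_sumr.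
  rewrite exchange_big; apply: eq_bigr => i _.
  under [RHS]eq_bigr do rewrite mulr_sumr.
  rewrite [RHS]exchange_big; apply: eq_bigr => s _ /=.
  have -> : D (M i (s i)) = \sum_k A i k * M k (s i).
    by have /matrixP/(_ i (s i)) := AM; rewrite !mxE.
  rewrite mulr_suml mulr_sumr; apply: eq_bigr => k _.
  rewrite [in RHS](bigD1 i) //= mxE eqxx [RHS]mulrCA -!mulrA; do 3!congr (_ * _).
  by apply: eq_bigr => j /negPf ne_ji; rewrite mxE ne_ji.
rewrite /mxtrace mulr_suml; apply: eq_bigr => i _.
rewrite (bigD1 i) //= detN eqxx big1 ?addr0 // => k ne_ki.
by rewrite detN eq_sym (negPf ne_ki) mulr0.
Qed.

(** A monomial [m] of the derivative comes from a monomial of [p] with one more factor z_i, hence of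
    degree one higher. *)
Lemma msize_mderiv_lt (K : idomainType) (n : nat) (p : mpoly n K) i :
  p != 0 -> (msize (mderiv i p) < msize p)%N.
Proof.
move=> p_neq0; rewrite msizeE.
have : (0 < msize p)%N by rewrite lt0n msize_poly_eq0.
move=> size_gt0; rewrite -(prednK size_gt0) ltnS; apply/bigmax_leqP_seq => m.
rewrite mcoeff_msupp mcoeff_mderiv => pm _; rewrite -ltnS (prednK size_gt0).
have : mnm_add m (mnm1 i) \in msupp p.
  by rewrite mcoeff_msupp; apply: contraNneq pm => ->; rewrite mul0rn.
by move/msize_mdeg_lt; rewrite mdegD mdeg1 addn1.
Qed.

(** * Polynomial flows *)

Definition divergence (R : realType) (n : nat) (V : polyvf R n) : mpoly n (CC R) :=
  \sum_(i < n) mderiv i (V i).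

(** Convertible to the valuation inside [polynomial_flow]. The type [K] is arbitrary so that the
    entries can also be polynomials, which turns it into a substitution. *)
Definition time_point (K : Type) (n : nat) (t : K) (z : 'I_n -> K) : 'I_n.+1 -> K :=
  fun j => oapp z t (unlift ord0 j).

Lemma time_point0 (K : Type) (n : nat) (t : K) (z : 'I_n -> K) : time_point t z ord0 = t.
Proof. by rewrite /time_point unlift_none. Qed.

Lemma time_point_lift (K : Type) (n : nat) (t : K) (z : 'I_n -> K) i :
  time_point t z (lift ord0 i) = z i.
Proof. by rewrite /time_point liftK. Qed.

Lemma time_pointK (K : Type) (n : nat) (v : 'I_n.+1 -> K) :
  time_point (v ord0) (fun i => v (lift ord0 i)) = v.
Proof.
apply/funext => j; case: (unliftP ord0 j) => [i ->|->].
  by rewrite time_point_lift.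
by rewrite time_point0.
Qed.

Lemma is_derive_time (K : numFieldType) (n : nat) (p : mpoly n.+1 K) (t : K) (z : 'I_n -> K) :
  is_derive t (1 : K) (fun s => meval (time_point s z) p)
    (meval (time_point t z) (mderiv ord0 p)).
Proof.
have h j : is_derive t (1 : K) (fun s => time_point s z j) (j == ord0)%:R.
  case: (unliftP ord0 j) => [i ->|->].
    rewrite [X in is_derive _ _ X](_ : _ = cst (z i)); first exact: is_derive_cst.
    by apply/funext => s; rewrite time_point_lift.
  rewrite [X in is_derive _ _ X](_ : _ = id); first exact: is_derive_id.
  by apply/funext => s; rewrite time_point0.
apply: is_derive_eq (is_derive_meval p h) _.
rewrite (bigD1 ord0) //= mulr1 big1 ?addr0 // => j /negPf ->.
by rewrite mulr0.
Qed.

(** Restriction to time 0 as a substitution: composing with it is a ring morphism, and so commutes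
    with determinants. *)
Definition at_time0 (K : comNzRingType) (n : nat) : n.+1.-tuple (mpoly n K) :=
  [tuple time_point 0 (fun i => mpolyX K (mnm1 i)) j | j < n.+1].

Lemma meval_at_time0 (K : comNzRingType) (n : nat) (p : mpoly n.+1 K) (z : 'I_n -> K) :
  meval z (comp_mpoly (at_time0 K n) p) = meval (time_point 0 z) p.
Proof.
rewrite comp_mpoly_meval; apply: meval_eq => k; rewrite tnth_mktuple.
case: (unliftP ord0 k) => [j ->|->]; first by rewrite !time_point_lift mevalXU.
by rewrite !time_point0 meval0.
Qed.

Lemma mderiv_at_time0 (K : comNzRingType) (n : nat) (p : mpoly n.+1 K) (j : 'I_n) :
  mderiv j (comp_mpoly (at_time0 K n) p) =
  comp_mpoly (at_time0 K n) (mderiv (lift ord0 j) p).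
Proof.
rewrite mderiv_comp_mpoly big_ord_recl tnth_mktuple time_point0 mderiv0 mulr0 add0r.
rewrite (bigD1 j) //= tnth_mktuple time_point_lift mderiv_mpolyX eqxx mulr1.
rewrite big1 ?addr0 // => k /negPf ne_kj.
by rewrite tnth_mktuple time_point_lift mderiv_mpolyX eq_sym ne_kj mulr0.
Qed.

Lemma polynomial_flow_divergence0 (R : realType) (n : nat) (V : polyvf R n) :
  polynomial_flow V -> divergence V = 0.
Proof.
case=> phi [phi0 phiD] [P PE]; pose PT := [tuple P i | i < n].
have {}PE t z i : phi t z i = meval (time_point t z) (P i) := PE t z i.
have PT0 z : (fun i => meval (time_point 0 z) (tnth PT i)) = z.
  by apply/funext => i; rewrite tnth_mktuple -PE phi0.
(* The flow equation becomes an identity between polynomials: both sides evaluate to the time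
   derivative of the same function at every point. *)
have dP i : mderiv ord0 (P i) = comp_mpoly PT (V i).
  apply/eqP; rewrite -subr_eq0; apply/eqP/meval_eq0 => v.
  rewrite -[v]time_pointK; move: (v ord0) (fun i => _) => t z.
  rewrite mevalB comp_mpoly_meval; apply/eqP; rewrite subr_eq0; apply/eqP.
  apply: (is_derive_unique (is_derive_time (P i) t z)).
  have := phiD t z i.
  rewrite [X in is_derive _ _ X](_ : _ = fun s => meval (time_point s z) (P i)).
    move=> h; apply: is_derive_eq h _.
    by apply: meval_eq => k; rewrite tnth_mktuple PE.
  by apply/funext => s; rewrite PE.
pose M : 'M[mpoly n.+1 (CC R)]_n := \matrix_(i, j) mderiv (lift ord0 j) (P i).
pose A : 'M[mpoly n.+1 (CC R)]_n := \matrix_(i, k) comp_mpoly PT (mderiv k (V i)).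
(* Differentiating the flow equation in z gives the linear equation satisfied by the Jacobian matrix
   [M], whose coefficient matrix [A] is the Jacobian of [V] along the flow. *)
have AM : map_mx (mderiv ord0) M = A *m M.
  apply/matrixP => i j; rewrite !mxE mderiv_comm dP mderiv_comp_mpoly.
  by apply: eq_bigr => k _; rewrite !mxE tnth_mktuple.
pose S0 := at_time0 (CC R) n.
have S0P i : comp_mpoly S0 (P i) = mpolyX _ (mnm1 i).
  apply/eqP; rewrite -subr_eq0; apply/eqP/meval_eq0 => z.
  by rewrite mevalB meval_at_time0 mevalXU -PE phi0 subrr.
(* At time 0 the flow is the identity, so [M] specialises to the identity matrix. *)
have detM : \det M != 0.
  suff /(congr1 determinant) : map_mx (comp_mpoly S0) M = 1%:M.
    by rewrite det_map_mx det1 => h; apply: contra_eq_neq h => ->; rewrite rmorph0 eq_sym oner_eq0.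
  apply/matrixP => i j; rewrite !mxE.
  by rewrite -mderiv_at_time0 S0P mderiv_mpolyX eq_sym.
(* The time derivative of [\det M] is [\tr A * \det M]. If the trace were nonzero, this product
   would be at least as large in degree as [\det M], whereas differentiation strictly lowers the
   size. *)
have tr0 : \tr A = 0.
  apply/eqP; apply: contraT => trA.
  have := msize_mderiv_lt ord0 detM.
  have -> := liouville_det (@mderivM _ _ ord0) AM.
  have size_gt0 : (0 < msize (\tr A))%N by rewrite lt0n msize_poly_eq0.
  by rewrite msizeM // -(prednK size_gt0) addSn /= ltnNge leq_addl.
(* The trace of [A] is the divergence composed with the flow; evaluating at time 0 recovers the
   divergence itself. *)
apply: meval_eq0 => z; rewrite -{1}[z]PT0 -comp_mpoly_meval.
suff -> : comp_mpoly PT (divergence V) = \tr A by rewrite tr0 meval0.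
by rewrite /divergence raddf_sum; apply: eq_bigr => i _; rewrite mxE.
Qed.

(** The hypothesis expresses, through substitutions, that [V i] depends only on variables of smaller
    rank. The coordinates of the flow are then found rank by rank, each as a polynomial
    antiderivative in time of a function already known. *)
Lemma triangular_polynomial_flow (R : realType) (n : nat) (V : polyvf R n)
    (rank : 'I_n -> nat) :
  (forall i (P Q : n.-tuple (mpoly n.+1 (CC R))),
     (forall j, (rank j < rank i)%N -> tnth P j = tnth Q j) ->
     comp_mpoly P (V i) = comp_mpoly Q (V i)) ->
  polynomial_flow V.
Proof.
move=> Vtri.
have solve m : exists P : n.-tuple (mpoly n.+1 (CC R)), forall i, (rank i < m)%N ->
    mderiv ord0 (tnth P i) = comp_mpoly P (V i) /\
    forall z, meval (time_point 0 z) (tnth P i) = z i.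
  elim: m => [|m [P PP]]; first by exists [tuple 0 | _ < n].
  have [q qP] := choice (fun i => antiderivative ord0 (comp_mpoly P (V i))).
  (* All coordinates of rank at least [m] are reset here, but only those of rank exactly [m] become
     solutions in this round. The term z_i carries the initial value, since [q i] vanishes at time
     0. *)
  pose P' := [tuple if (rank i < m)%N then tnth P i
                    else mpolyX (CC R) (mnm1 (lift ord0 i)) + q i | i < n].
  have eqP' j : (rank j < m)%N -> tnth P' j = tnth P j.
    by move=> jm; rewrite tnth_mktuple jm.
  exists P' => i; rewrite ltnS leq_eqVlt => /orP[/eqP im|im]; last first.
    rewrite eqP' //; have [-> P0] := PP i im; split; last exact: P0.
    by apply: Vtri => j ji; rewrite eqP' // (ltn_trans ji).
  rewrite tnth_mktuple im ltnn; have [dq q0] := qP i; split=> [|z].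
    rewrite mderivD dq mderiv_mpolyX add0r; apply: Vtri => j ji.
    by rewrite eqP' // -im.
  by rewrite mevalD mevalXU q0 ?time_point0 // time_point_lift addr0.
have [P PP] := solve (\max_i rank i).+1.
have {}PP i := PP i (leq_bigmax i).
exists (fun t z i => meval (time_point t z) (tnth P i)); last by exists (tnth P).
split=> [z|t z i]; first by apply/funext => i; have [_ ->] := PP i.
have [dP _] := PP i; apply: is_derive_eq (is_derive_time _ _ _) _.
by rewrite dP comp_mpoly_meval.
Qed.

Lemma polynomial_flow_complete (R : realType) (n : nat) (V : polyvf R n) :
  polynomial_flow V -> complete V.
Proof. by case=> phi phiV _; exists phi. Qed.

Lemma Uvf_polynomial_flow (R : realType) (n : nat) : polynomial_flow (Uvf R n).
Proof.
by apply: (@triangular_polynomial_flow _ _ _ (fun=> 0%N)) => i P Q _; rewrite ffunE !rmorph_nat.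
Qed.

Lemma comp_mpoly_eqD (K : comNzRingType) (m n : nat) (P Q : n.-tuple (mpoly m K))
    (p q : mpoly n K) :
  comp_mpoly P p = comp_mpoly Q p -> comp_mpoly P q = comp_mpoly Q q ->
  comp_mpoly P (p + q) = comp_mpoly Q (p + q).
Proof. by rewrite !comp_mpolyD => -> ->. Qed.

Lemma comp_mpoly_eqM (K : comNzRingType) (m n : nat) (P Q : n.-tuple (mpoly m K))
    (p q : mpoly n K) :
  comp_mpoly P p = comp_mpoly Q p -> comp_mpoly P q = comp_mpoly Q q ->
  comp_mpoly P (p * q) = comp_mpoly Q (p * q).
Proof. by rewrite !rmorphM /= => -> ->. Qed.

Lemma comp_mpoly_eq_nat (K : comNzRingType) (m n : nat) (P Q : n.-tuple (mpoly m K))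
    (k : nat) : comp_mpoly P k%:R = comp_mpoly Q k%:R.
Proof. by rewrite !rmorph_nat. Qed.

Lemma comp_mpoly_eqX (K : comNzRingType) (m n : nat) (P Q : n.-tuple (mpoly m K)) j (e : nat) :
  tnth P j = tnth Q j ->
  comp_mpoly P (mpolyX K (mnm1 j) ^+ e) = comp_mpoly Q (mpolyX K (mnm1 j) ^+ e).
Proof. by rewrite !rmorphXn /= /comp_mpoly !mmapX !mmap1U => ->. Qed.

(** Only the summands pointing in direction [i] contribute to component [i]. The index set [J] and
    target [f] are left free so as to cover both V' and V''. *)
Lemma triangular_sum (R : realType) (n : nat) (J : pred 'I_n) (C : 'I_n -> mpoly n (CC R))
    (f : 'I_n -> nat) (l : nat) (i : 'I_n) (P Q : n.-tuple (mpoly n.+1 (CC R))) :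
  (forall k, J k -> f k = i -> comp_mpoly P (C k) = comp_mpoly Q (C k)) ->
  comp_mpoly P ((dz R n l + \sum_(k < n | J k) vfmul (C k) (dz R n (f k))) i) =
  comp_mpoly Q ((dz R n l + \sum_(k < n | J k) vfmul (C k) (dz R n (f k))) i).
Proof.
move=> CJ; rewrite ffunE sum_ffunE; apply: comp_mpoly_eqD.
  by rewrite ffunE; exact: comp_mpoly_eq_nat.
apply: (big_ind (fun p => comp_mpoly P p = comp_mpoly Q p)) => [|p q|k Jk].
- exact: (comp_mpoly_eq_nat P Q 0).
- exact: comp_mpoly_eqD.
rewrite ffunE [dz _ _ _ _]ffunE; have [ki|_] := eqVneq (f k) i.
  by apply: comp_mpoly_eqM; [exact: CJ|exact: comp_mpoly_eq_nat].
by rewrite mulr0; exact: (comp_mpoly_eq_nat P Q 0).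
Qed.

Lemma comp_chain_coef_eq (R : realType) (m n : nat) (P Q : n.-tuple (mpoly m (CC R)))
    (J : pred 'I_n) (k : 'I_n) :
  tnth P k = tnth Q k -> (forall j, J j -> tnth P j = tnth Q j) ->
  comp_mpoly P ((\prod_(j < n | J j) zvar R j ^+ 2) * zvar R k ^+ 5) =
  comp_mpoly Q ((\prod_(j < n | J j) zvar R j ^+ 2) * zvar R k ^+ 5).
Proof.
move=> PQk PQJ; apply: comp_mpoly_eqM; last exact: comp_mpoly_eqX.
apply: (big_ind (fun p => comp_mpoly P p = comp_mpoly Q p)) => [|p q|j Jj].
- exact: (comp_mpoly_eq_nat P Q 1).
- exact: comp_mpoly_eqM.
by apply: comp_mpoly_eqX; exact: PQJ.
Qed.

Lemma V'vf_polynomial_flow (R : realType) (n : nat) : polynomial_flow (V'vf R n).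
Proof.
(* The component along d_(k-1) involves only z_k and later variables, so the rank decreases with the
   index. *)
apply: (@triangular_polynomial_flow _ _ _ (fun i => n - i)%N) => i P Q PQ.
apply: triangular_sum => k k_gt0 ki; apply: comp_chain_coef_eq => [|j kj]; apply: PQ.
  by have := ltn_ord k; lia.
by have := ltn_ord j; lia.
Qed.

Lemma V''vf_polynomial_flow (R : realType) (n : nat) : polynomial_flow (V''vf R n).
Proof.
apply: (@triangular_polynomial_flow _ _ _ (fun i => i)) => i P Q PQ.
apply: triangular_sum => k _ ki; apply: comp_chain_coef_eq => [|j jk]; apply: PQ.
  by rewrite -ki.
by rewrite -ki ltnS ltnW.
Qed.

(** * Brackets of polynomial fields *)

(* The operations of Defs, over an arbitrary field; at CC R they are convertible
   to the original ones. *)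
Section Brackets.
Variables (K : numClosedFieldType) (n : nat).

Definition vfield := {ffun 'I_n -> mpoly n K}.
Implicit Types (V W : vfield) (p q : mpoly n K) (i j : 'I_n).

Definition pvar (i : 'I_n) : mpoly n K := mpolyX K (mnm1 i).

Definition coord (k : nat) : vfield := [ffun i : 'I_n => (k == i)%:R].

Definition pscale p V : vfield := [ffun i => p * V i].

Definition lie_derivative V p : mpoly n K := \sum_(j < n) V j * mderiv j p.

Definition commutator V W : vfield :=
  [ffun i => lie_derivative V (W i) - lie_derivative W (V i)].

Definition lie_closed (L : set vfield) : Prop :=
  [/\ L 0,
      forall V W, L V -> L W -> L (V + W),
      forall (a : K) V, L V -> L (a *: V)
    & forall V W, L V -> L W -> L (commutator V W)].

(** The field p d_i. Its flow is a shear when d_i p = 0, but [p] is arbitrary here so that brackets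
    stay within this form. *)
Definition shear p (i : 'I_n) : vfield := pscale p (coord i).

Lemma vfDE V W i : (V + W) i = V i + W i.
Proof. by rewrite ffunE. Qed.

Lemma vfNE V i : (- V) i = - V i.
Proof. by rewrite ffunE. Qed.

Lemma vfZE (c : K) V i : (c *: V) i = c *: V i.
Proof. by rewrite ffunE. Qed.

Lemma vf0E i : (0 : vfield) i = 0.
Proof. by rewrite ffunE. Qed.

Lemma commutatorE V W i :
  commutator V W i = lie_derivative V (W i) - lie_derivative W (V i).
Proof. by rewrite ffunE. Qed.

Lemma pscaleE p V i : pscale p V i = p * V i.
Proof. by rewrite ffunE. Qed.

Lemma shearE p i j : shear p i j = p * (i == j)%:R.
Proof. by rewrite !ffunE. Qed.

Lemma shearD p q i : shear (p + q) i = shear p i + shear q i.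
Proof. by apply/ffunP => j; rewrite vfDE !shearE mulrDl. Qed.

Lemma shearZ (c : K) p i : shear (c *: p) i = c *: shear p i.
Proof. by apply/ffunP => j; rewrite vfZE !shearE scalerAl. Qed.

Lemma shear0 i : shear 0 i = 0.
Proof. by apply/ffunP => j; rewrite vf0E shearE mul0r. Qed.

Lemma shear1 i : shear 1 i = coord i.
Proof. by apply/ffunP => j; rewrite pscaleE mul1r. Qed.

Lemma lie_derivative_shear p i q : lie_derivative (shear p i) q = p * mderiv i q.
Proof.
rewrite /lie_derivative (bigD1 i) //= shearE eqxx mulr1 big1 ?addr0 // => j /negPf.
by rewrite eq_sym shearE => ->; rewrite mulr0 mul0r.
Qed.

Lemma mderiv_natr i p (k : nat) : mderiv i (p * k%:R) = mderiv i p * k%:R.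
Proof. by rewrite !mulr_natr mderivMn. Qed.

Lemma commutator_shear p i q j :
  commutator (shear p i) (shear q j) =
  shear (p * mderiv i q) j - shear (q * mderiv j p) i.
Proof.
apply/ffunP => k; rewrite vfDE vfNE commutatorE !shearE !lie_derivative_shear.
by rewrite !mderiv_natr !mulrA.
Qed.

Lemma lie_derivativeDl V W p :
  lie_derivative (V + W) p = lie_derivative V p + lie_derivative W p.
Proof. by rewrite -big_split; apply: eq_bigr => j _; rewrite vfDE mulrDl. Qed.

Lemma lie_derivativeD V p q :
  lie_derivative V (p + q) = lie_derivative V p + lie_derivative V q.
Proof. by rewrite -big_split; apply: eq_bigr => j _; rewrite mderivD mulrDr. Qed.

Lemma commutatorDl V1 V2 W : commutator (V1 + V2) W = commutator V1 W + commutator V2 W.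
Proof.
apply/ffunP => i; rewrite !(vfDE, commutatorE) lie_derivativeDl lie_derivativeD.
by rewrite opprD addrACA.
Qed.

Lemma commutator_coord i V : commutator (coord i) V = [ffun j => mderiv i (V j)].
Proof.
apply/ffunP => j; rewrite commutatorE [RHS]ffunE -shear1 lie_derivative_shear mul1r.
rewrite shearE mul1r [X in _ - X]big1 ?subr0 // => k _.
by rewrite -[_%:R]mul1r mderiv_natr mderivC mul0r mulr0.
Qed.

Lemma commutator_coordD i V W :
  commutator (coord i) (V + W) = commutator (coord i) V + commutator (coord i) W.
Proof.
by apply/ffunP => j; rewrite !commutator_coord !(vfDE, ffunE) mderivD.
Qed.

Lemma commutator_coord_pscale i p V :
  commutator (coord i) (pscale p V) =
  pscale (mderiv i p) V + pscale p (commutator (coord i) V).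
Proof.
apply/ffunP => j; rewrite !commutator_coord !(vfDE, ffunE).
by rewrite mderivM.
Qed.

Lemma commutator_coord_shear i p j : commutator (coord i) (shear p j) = shear (mderiv i p) j.
Proof.
by apply/ffunP => k; rewrite commutator_coord [LHS]ffunE !shearE mderiv_natr.
Qed.

Lemma pscaleD p V W : pscale p (V + W) = pscale p V + pscale p W.
Proof. by apply/ffunP => i; rewrite !(vfDE, pscaleE) mulrDr. Qed.

Lemma pscale0 p : pscale p 0 = 0.
Proof. by apply/ffunP => i; rewrite pscaleE !vf0E mulr0. Qed.

Lemma pscale0l V : pscale 0 V = 0.
Proof. by apply/ffunP => i; rewrite pscaleE !vf0E mul0r. Qed.

Lemma pscale_shear p q i : pscale p (shear q i) = shear (p * q) i.
Proof. by apply/ffunP => j; rewrite pscaleE !shearE mulrA. Qed.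

(** For a = 0 the truncated exponent [a.-1] is harmless, because the coefficient is then 0. *)
Lemma mderiv_pvarX i j a :
  mderiv i (pvar j ^+ a) = (i == j)%:R * a%:R *: pvar j ^+ a.-1.
Proof.
elim: a => [|a IH]; first by rewrite expr0 mderivC mulr0 scale0r.
rewrite exprS mderivM IH mderiv_mpolyX -scalerAr.
case: a {IH} => [|a] /=; first by rewrite !expr0 !mulr1 mulr0 scale0r addr0 scaler_nat.
rewrite -exprS -scaler_nat -scalerAl mul1r -scalerDl; congr (_ *: _).
by case: (i == j); rewrite ?mul0r ?addr0 // !mul1r -natr1 addrC -natr1 ?natr1.
Qed.

Lemma mderiv_pvarXx i a : mderiv i (pvar i ^+ a) = a%:R *: pvar i ^+ a.-1.
Proof. by rewrite mderiv_pvarX eqxx mul1r. Qed.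

Lemma mderiv_pvarX0 i j a : i != j -> mderiv i (pvar j ^+ a) = 0.
Proof. by move=> /negPf ne_ij; rewrite mderiv_pvarX ne_ij mul0r scale0r. Qed.

Lemma mderiv_mul0 i p q : mderiv i p = 0 -> mderiv i q = 0 -> mderiv i (p * q) = 0.
Proof. by rewrite mderivM => -> ->; rewrite mul0r mulr0 addr0. Qed.

Lemma mderiv_prod0 (I : Type) (r : seq I) (P : pred I) (F : I -> mpoly n K) i :
  (forall k, P k -> mderiv i (F k) = 0) -> mderiv i (\prod_(k <- r | P k) F k) = 0.
Proof.
move=> F0; apply: (big_ind (fun p => mderiv i p = 0)) => // [|p q].
  exact: mderivC.
exact: mderiv_mul0.
Qed.

End Brackets.

(** * Generation of the divergence-free fields *)

Section Generation.
Variables (K : numClosedFieldType) (n : nat) (L : set (vfield K n)).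
Hypothesis Lcl : lie_closed L.
Implicit Types (V W : vfield K n) (p q : mpoly n K) (i j : 'I_n).

Lemma closed0 : L 0.
Proof. by case: Lcl. Qed.

Lemma closedD V W : L V -> L W -> L (V + W).
Proof. by case: Lcl => _ + _ _; apply. Qed.

Lemma closedZ c V : L V -> L (c *: V).
Proof. by case: Lcl => _ _ + _; apply. Qed.

Lemma closed_commutator V W : L V -> L W -> L (commutator V W).
Proof. by case: Lcl => _ _ _; apply. Qed.

Lemma closedN V : L V -> L (- V).
Proof. by rewrite -scaleN1r; exact: closedZ. Qed.

Lemma closed_sum (I : Type) (r : seq I) (P : pred I) (F : I -> vfield K n) :
  (forall k, P k -> L (F k)) -> L (\sum_(k <- r | P k) F k).
Proof. by apply: big_ind; [exact: closed0|exact: closedD]. Qed.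

Lemma closedZ_inv c V : c != 0 -> L (c *: V) -> L V.
Proof. by move=> c0 /(closedZ c^-1); rewrite scalerA mulVf // scale1r. Qed.

(** The condition d_j p = 0 removes the second term of the bracket [p d_i, q d_j], so that a single
    shear is left. *)
Lemma closed_shear_mul i j p q :
  mderiv j p = 0 -> L (shear p i) -> L (shear q j) -> L (shear (p * mderiv i q) j).
Proof.
move=> dp Lp Lq; have := closed_commutator Lp Lq.
by rewrite commutator_shear dp mulr0 shear0 subr0.
Qed.

(* With x = z_i and y = z_j, the field Y = [x^2 d_y, y d_x] = x^2 d_x - 2xy d_y
   satisfies [Y, x^a d_y] = (a + 2) x^(a+1) d_y. *)
Lemma closed_shear_raise i j a : i != j ->
  L (shear (pvar K i ^+ 2) j) -> L (shear (pvar K j ^+ 1) i) ->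
  L (shear (pvar K i ^+ a.+1) j) -> L (shear (pvar K i ^+ a.+2) j).
Proof.
move=> ne_ij Lx2 Ly Lxa.
have ne_ji : j != i by rewrite eq_sym.
have := closed_commutator (closed_commutator Lx2 Ly) Lxa.
rewrite [commutator (shear (_ ^+ 2) j) _]commutator_shear commutatorDl.
rewrite -scaleN1r -shearZ !commutator_shear !mderiv_pvarXx (mderiv_pvarX0 K _ ne_ji) mulr0 shear0.
have -> : mderiv j (pvar K i ^+ 2 * (1 *: pvar K j ^+ 1.-1)) = 0.
  by rewrite expr0 scale1r mulr1; exact: mderiv_pvarX0.
have -> : mderiv j (-1 *: (pvar K j ^+ 1 * (2 *: pvar K i ^+ 2.-1))) = -2 *: pvar K i ^+ 1.
  rewrite mderivZ mderivM mderivZ (mderiv_pvarX0 K _ ne_ji) scaler0 mulr0 addr0.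
  by rewrite mderiv_pvarXx scale1r expr0 mul1r scalerA mulN1r.
rewrite mulr0 shear0 subr0 sub0r scale1r expr0 mulr1 -!scalerAr -!exprD addn1 add2n.
rewrite !shearZ -scaleNr opprK -scalerDl => /closedZ_inv; apply.
by rewrite -natrD pnatr_eq0.
Qed.

Lemma closed_pow i j a : i != j ->
  L (coord K n j) -> L (shear (pvar K i ^+ 1) j) ->
  L (shear (pvar K i ^+ 2) j) -> L (shear (pvar K j ^+ 1) i) ->
  L (shear (pvar K i ^+ a) j).
Proof.
move=> ne_ij L0 L1 L2 Lji; case: a => [|a]; first by rewrite expr0 shear1.
by elim: a => [//|a IH]; apply: closed_shear_raise.
Qed.

Hypothesis Lpow : forall i j a, i != j -> L (shear (pvar K i ^+ a) j).
Hypothesis Lcoord : forall j, L (coord K n j).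

(** One variable is adjoined at a time. If p is the product over [r], which contains neither z_k nor
    z_i, then [p d_k, z_k^(e+1) d_i] = (e+1) z_k^e p d_i. The inductive hypothesis is therefore
    applied in direction [k] instead of [i]. *)
Lemma closed_shear_prod i (r : seq 'I_n) (e : 'I_n -> nat) : uniq r -> i \notin r ->
  L (shear (\prod_(k <- r) pvar K k ^+ e k) i).
Proof.
elim: r i => [|k r IH] i; first by rewrite big_nil shear1.
rewrite /= inE negb_or => /andP[kr ur] /andP[ne_ik ir]; rewrite big_cons.
have d0 : mderiv i (\prod_(k <- r) pvar K k ^+ e k) = 0.
  rewrite big_seq; apply: mderiv_prod0 => l lr; apply: mderiv_pvarX0.
  by apply: contraNneq ir => ->.
have ne_ki : k != i by rewrite eq_sym.
have := closed_shear_mul d0 (IH k ur kr) (Lpow (e k).+1 ne_ki).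
rewrite mderiv_pvarXx -scalerAr shearZ mulrC => /closedZ_inv; apply.
by rewrite pnatr_eq0.
Qed.

Lemma mpolyX_factor i (m : multinom n) :
  mpolyX K m = pvar K i ^+ m i * \prod_(k < n | k != i) pvar K k ^+ m k.
Proof. by rewrite mpolyXE_id (bigD1 i). Qed.

Lemma mderiv_off i (m : multinom n) :
  mderiv i (\prod_(k < n | k != i) pvar K k ^+ m k) = 0.
Proof. by apply: mderiv_prod0 => k ki; apply: mderiv_pvarX0; rewrite eq_sym. Qed.

Lemma closed_shear_off i (m : multinom n) :
  L (shear (\prod_(k < n | k != i) pvar K k ^+ m k) i).
Proof.
rewrite -big_filter; apply: closed_shear_prod; first by rewrite filter_uniq ?index_enum_uniq.
by rewrite mem_filter eqxx.
Qed.

Lemma closed_shear i p : mderiv i p = 0 -> L (shear p i).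
Proof.
move=> dp; rewrite [p]mpolyE big_seq.
rewrite (big_morph (fun q => shear q i) (fun q r => shearD q r i) (shear0 _ i)).
apply: closed_sum => m; rewrite mcoeff_msupp shearZ => pm; apply: closedZ.
rewrite (mpolyX_factor i); suff -> : m i = 0%N.
  by rewrite expr0 mul1r; exact: closed_shear_off.
apply/eqP; apply: contraNT pm => mi.
(* If z_i occurred in the monomial [m], then d_i p would have, at [m] lowered by one in z_i, the
   coefficient of [m] in [p] times the positive integer [m i]. *)
have mE : mnm_add (mnm_sub m (mnm1 i)) (mnm1 i) = m.
  by rewrite submK //; apply/mnm_lepP => k; rewrite mnm1E; case: eqP => // <-; rewrite lt0n.
have /eqP := congr1 (mcoeff (mnm_sub m (mnm1 i))) dp.
by rewrite mcoeff_mderiv mE mcoeff0 mulrn_eq0.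
Qed.

(** The Hamiltonian field of [p] in the plane of z_i and z_j, the other variables being
    parameters. *)
Definition hamiltonian i j p : vfield K n := shear (mderiv j p) i - shear (mderiv i p) j.

(** By linearity [p] may be a monomial q r, where r is a power of z_j and q is free of z_j. Then
    [q d_j, r d_i] = q (d_j r) d_i - r (d_i q) d_j is exactly the Hamiltonian field of q r. *)
Lemma closed_hamiltonian i j p : i != j -> L (hamiltonian i j p).
Proof.
move=> ne_ij; elim/mpolyind: p => [|c m p _ _ Lp].
  by rewrite /hamiltonian !mderiv0 !shear0 subr0; exact: closed0.
have -> : hamiltonian i j (c *: mpolyX K m + p) =
    c *: hamiltonian i j (mpolyX K m) + hamiltonian i j p.
  rewrite /hamiltonian !mderivD !mderivZ !shearD !shearZ scalerBr opprD.
  by rewrite addrACA.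
apply: closedD => //; apply: closedZ; rewrite (mpolyX_factor j).
set q := \prod_(k < n | _) _; set r := pvar K j ^+ m j.
have dq : mderiv j q = 0 := mderiv_off j m.
have dr : mderiv i r = 0 by exact: mderiv_pvarX0.
have Lr : L (shear r i) by exact: closed_shear.
have := closed_commutator (closed_shear_off j m) Lr; rewrite -/q commutator_shear.
by rewrite /hamiltonian !mderivM dq dr mulr0 addr0 mul0r add0r [q * _]mulrC.
Qed.

End Generation.

Lemma closed_divergence0 (K : numClosedFieldType) (n : nat) (L : set (vfield K n.+1))
    (V : vfield K n.+1) : lie_closed L ->
  (forall i j a, i != j -> L (shear (pvar K i ^+ a) j)) ->
  (forall j : 'I_n.+1, L (coord K n.+1 j)) ->
  \sum_(i < n.+1) mderiv i (V i) = 0 -> L V.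
Proof.
move=> Lcl Lpow Lcoord divV.
have [f fP] := choice (fun j => antiderivative ord0 (V j)).
have {}fP j : mderiv ord0 (f j) = V j by case: (fP j).
(* Subtracting the Hamiltonian fields of the [f j] restores each [V j] with j different from 0, at
   the cost of -d_j (f j) in direction 0; [g] compensates for this. Since d_0 d_j (f j) = d_j (V j),
   the derivative d_0 g is the divergence of [V]. *)
pose g := V ord0 + \sum_(j < n.+1 | j != ord0) mderiv j (f j).
have Lg : L (shear g ord0).
  apply: closed_shear => //; rewrite mderivD -[RHS]divV [RHS](bigD1 ord0) //=; congr (_ + _).
  by rewrite raddf_sum; apply: eq_bigr => j _; rewrite /= mderiv_comm fP.
have -> : V = shear g ord0 - \sum_(j < n.+1 | j != ord0) hamiltonian ord0 j (f j).
  apply/ffunP => k; rewrite vfDE vfNE sum_ffunE shearE.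
  have ham j : hamiltonian ord0 j (f j) k = mderiv j (f j) * (ord0 == k)%:R - V j * (j == k)%:R.
    by rewrite vfDE vfNE !shearE fP.
  under eq_bigr do rewrite ham.
  have [<-|ne_k0] := eqVneq ord0 k.
    rewrite mulr1 /g -[LHS]addr0 -addrA; congr (_ + _).
    rewrite -sumrB big1 // => j /negPf ne_j0.
    by rewrite ne_j0 mulr0 subr0 mulr1 subrr.
  rewrite mulr0 sub0r (bigD1 k) 1?eq_sym //= eqxx mulr0 sub0r mulr1.
  rewrite big1 ?addr0 ?opprK // => j /andP[_ /negPf ->].
  by rewrite !mulr0 subr0.
apply: closedD => //; apply: closedN => //; apply: closed_sum => // j.
by rewrite eq_sym => ne_j0; exact: closed_hamiltonian.
Qed.


(** * Extracting shears from a chain of coordinates *)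

Section Chain.
Variables (K : numClosedFieldType) (n : nat) (L : set (vfield K n)).
Hypothesis Lcl : lie_closed L.
Variables (s : nat -> 'I_n) (N : nat).
Hypothesis s_inj : forall k l, (k <= N)%N -> (l <= N)%N -> s k = s l -> k = l.

(** The common form of V' and V'' without their leading coordinate field: [s] lists the coordinates
    downwards for V' and upwards for V''. Starting at [m] gives the tails on which the induction
    runs. *)
Definition chain m : vfield K n :=
  \sum_(m <= k < N)
    shear ((\prod_(m <= j < k) pvar K (s j) ^+ 2) * pvar K (s k) ^+ 5) (s k.+1).

Lemma chain_rec m : (m < N)%N ->
  chain m = shear (pvar K (s m) ^+ 5) (s m.+1) + pscale (pvar K (s m) ^+ 2) (chain m.+1).
Proof.
move=> mN; rewrite /chain big_ltn // big_geq // mul1r; congr (_ + _).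
rewrite (big_morph (pscale _) (pscaleD _) (pscale0 _)) big_nat [RHS]big_nat.
apply: eq_bigr => k /andP[mk _]; rewrite pscale_shear mulrA.
by rewrite big_ltn.
Qed.

Lemma commutator_coord_chain (i : 'I_n) m : (forall k, (m <= k <= N)%N -> i != s k) ->
  commutator (coord K n i) (chain m) = 0.
Proof.
move=> im; rewrite /chain big_nat.
apply: (big_ind (fun V => commutator (coord K n i) V = 0)) => [|V W VE WE|k /andP[mk kN]].
- by rewrite -(shear0 _ i) commutator_coord_shear mderiv0.
- by rewrite commutator_coordD VE WE addr0.
rewrite commutator_coord_shear mderiv_mul0 ?shear0 //.
  rewrite big_nat; apply: mderiv_prod0 => j /andP[mj jk].
  by apply: mderiv_pvarX0; apply: im; rewrite mj (leq_trans (ltnW jk)) ?(ltnW kN).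
by apply: mderiv_pvarX0; apply: im; rewrite mk ltnW.
Qed.

(** The bracket with d_i preserves the shape c z_i^a d_j + d z_i^b W, so it can be iterated while
    only the scalars and exponents change. *)
Lemma commutator_coord_step (i j : 'I_n) a b (c d : K) W : commutator (coord K n i) W = 0 ->
  commutator (coord K n i)
    (shear (c *: pvar K i ^+ a) j + pscale (d *: pvar K i ^+ b) W) =
  shear ((c * a%:R) *: pvar K i ^+ a.-1) j + pscale ((d * b%:R) *: pvar K i ^+ b.-1) W.
Proof.
move=> WE; rewrite commutator_coordD commutator_coord_shear commutator_coord_pscale WE.
by rewrite pscale0 addr0 !mderivZ !mderiv_pvarXx !scalerA.
Qed.

(** Write x for the variable [s m], d for the next coordinate field and W for the next tail.
    Repeated brackets with d/dx take x^5 d + x^2 W to 5 x^4 d + 2 x W, then 20 x^3 d + 2 W, then 60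
    x^2 d, 120 x d and 120 d. The exponents 5 and 2 thus let W disappear while x^2 d is still to
    come. The field W is never isolated, only its bracket with d, which is why the invariant
    concerns that bracket. *)
Lemma chain_step m : (m < N)%N ->
  L (coord K n (s m)) -> L (commutator (coord K n (s m)) (chain m)) ->
  [/\ L (shear (pvar K (s m) ^+ 2) (s m.+1)), L (shear (pvar K (s m) ^+ 1) (s m.+1)),
      L (coord K n (s m.+1)) & L (commutator (coord K n (s m.+1)) (chain m.+1))].
Proof.
move=> mN Lm L0.
have W0 : commutator (coord K n (s m)) (chain m.+1) = 0.
  apply: commutator_coord_chain => k /andP[mk kN].
  by apply/eqP => /(s_inj (ltnW mN) kN) mk'; rewrite mk' ltnn in mk.
have L1 := L0; rewrite chain_rec // -[pvar K (s m) ^+ 5]scale1r in L1.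
rewrite -[pvar K (s m) ^+ 2]scale1r commutator_coord_step // in L1.
have := closed_commutator Lcl Lm L1; rewrite commutator_coord_step // => L2.
have := closed_commutator Lcl Lm L2; rewrite commutator_coord_step // => L3.
have := closed_commutator Lcl Lm L3; rewrite commutator_coord_step // => L4.
have := closed_commutator Lcl Lm L4; rewrite commutator_coord_step // => L5.
have Lc : L (coord K n (s m.+1)).
  rewrite -shear1 -(expr0 (pvar K (s m))).
  apply: (closedZ_inv Lcl _ (c := 1 * 5 * 4 * 3 * 2 * 1)); last first.
    by rewrite -shearZ; move: L5; rewrite /= !mulr0 scale0r pscale0l addr0.
  by rewrite !mulf_neq0 ?oner_eq0 ?pnatr_eq0.
split=> //.
- apply: (closedZ_inv Lcl _ (c := 1 * 5 * 4 * 3)); last first.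
    by rewrite -shearZ; move: L3; rewrite /= !mulr0 scale0r pscale0l addr0.
  by rewrite !mulf_neq0 ?oner_eq0 ?pnatr_eq0.
- apply: (closedZ_inv Lcl _ (c := 1 * 5 * 4 * 3 * 2)); last first.
    by rewrite -shearZ; move: L4; rewrite /= !mulr0 scale0r pscale0l addr0.
  by rewrite !mulf_neq0 ?oner_eq0 ?pnatr_eq0.
(* In 20 x^3 d + 2 W, the bracket with d kills the first term, as x is not the variable of d. *)
have := closed_commutator Lcl Lc L2.
rewrite commutator_coordD commutator_coord_shear commutator_coord_pscale.
rewrite !mderivZ /= expr0 mderivC scaler0 pscale0l add0r.
rewrite mderiv_pvarX0 ?scaler0 ?shear0 ?add0r; last first.
  by apply/eqP => /(s_inj mN (ltnW mN)) /eqP; rewrite gtn_eqF.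
have -> (c : K) V : pscale (c *: 1) V = c *: V.
  by apply/ffunP => k; rewrite pscaleE vfZE -scalerAl mul1r.
by move/(closedZ_inv Lcl); apply; rewrite !mulf_neq0 ?oner_eq0 ?pnatr_eq0.
Qed.

(** The induction starts from the bracket of the whole field with its own leading term, which leaves
    only the bracket with [chain 0]. *)
Lemma chain_closed : L (coord K n (s 0)) -> L (coord K n (s 0) + chain 0) ->
  forall m, (m <= N)%N -> L (coord K n (s m)) /\
    ((m < N)%N -> L (shear (pvar K (s m) ^+ 1) (s m.+1)) /\
                  L (shear (pvar K (s m) ^+ 2) (s m.+1))).
Proof.
move=> L0 LV.
have main m : (m <= N)%N ->
    L (coord K n (s m)) /\ L (commutator (coord K n (s m)) (chain m)).
  elim: m => [_|m IH mN].
    split=> //; have := closed_commutator Lcl L0 LV; rewrite commutator_coordD.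
    by rewrite -{2}shear1 commutator_coord_shear mderivC shear0 add0r.
  by have [Lm Lcm] := IH (ltnW mN); have [] := chain_step mN Lm Lcm.
move=> m mN; have [Lm Lcm] := main m mN; split=> // {}mN.
by have [] := chain_step mN Lm Lcm.
Qed.

End Chain.

Lemma big_nat_ord_lt (T : Type) (idx : T) (op : T -> T -> T) (F : nat -> T) (n N : nat) :
  (n <= N)%N ->
  \big[op/idx]_(0 <= k < n) F k = \big[op/idx]_(k < N | (k < n)%N) F k.
Proof. by move=> nN; rewrite big_mkord (big_ord_widen N F nN). Qed.

(** * From the two chains to all divergence-free fields *)

Section Assembly.
Variables (K : numClosedFieldType) (N : nat).

Lemma descending_chainE :
  \sum_(k < N.+1 | (0 < k)%N)
    pscale ((\prod_(j < N.+1 | (k < j)%N) pvar K j ^+ 2) * pvar K k ^+ 5) (coord K N.+1 k.-1) =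
  chain K (fun k => inord (N - k)) N 0.
Proof.
rewrite /chain (big_nat_ord_lt _ _ _ (leqnSn N)) (reindex_inj rev_ord_inj) /=.
apply: eq_big => [k|k kN]; first by rewrite subSS subn_gt0.
have ordE (j : 'I_N.+1) : rev_ord j = inord (N - j).
  by apply: val_inj; rewrite /= subSS inordK // ltnS leq_subr.
rewrite /shear subSS inordK ?ltnS ?leq_subr // -subnS -ordE; congr (pscale (_ * _) _).
rewrite (big_nat_ord_lt _ _ _ (ltnW (ltn_ord k))) (reindex_inj rev_ord_inj) /=.
apply: eq_big => [j|j _]; last by rewrite ordE.
by have := ltn_ord j; have := ltn_ord k; lia.
Qed.

Lemma ascending_chainE :
  \sum_(k < N.+1 | (k.+1 < N.+1)%N)
    pscale ((\prod_(j < N.+1 | (j < k)%N) pvar K j ^+ 2) * pvar K k ^+ 5) (coord K N.+1 k.+1) =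
  chain K inord N 0.
Proof.
rewrite /chain (big_nat_ord_lt _ _ _ (leqnSn N)).
apply: eq_bigr => k kN; rewrite /shear inord_val inordK //; congr (pscale (_ * _) _).
rewrite (big_nat_ord_lt _ _ _ (ltnW (ltn_ord k))).
by apply: eq_bigr => j _; rewrite inord_val.
Qed.

(** The field U starts the descending chain, which reaches every coordinate field. In particular it
    reaches d_0, which starts the ascending chain. The two chains give shears between adjacent
    coordinates in both directions, and brackets along paths of neighbours give the rest. *)
Lemma divergence0_generated (L : set (vfield K N.+1)) (V : vfield K N.+1) : (0 < N)%N ->
  lie_closed L -> L (coord K N.+1 N) ->
  L (coord K N.+1 N + \sum_(k < N.+1 | (0 < k)%N)
       pscale ((\prod_(j < N.+1 | (k < j)%N) pvar K j ^+ 2) * pvar K k ^+ 5)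
         (coord K N.+1 k.-1)) ->
  L (coord K N.+1 0 + \sum_(k < N.+1 | (k.+1 < N.+1)%N)
       pscale ((\prod_(j < N.+1 | (j < k)%N) pvar K j ^+ 2) * pvar K k ^+ 5)
         (coord K N.+1 k.+1)) ->
  \sum_(i < N.+1) mderiv i (V i) = 0 -> L V.
Proof.
move=> N_gt0 Lcl LU; rewrite descending_chainE ascending_chainE => LV' LV''.
have inordE k : (k <= N)%N -> nat_of_ord (inord k : 'I_N.+1) = k by move=> kN; rewrite inordK.
have down k : (k <= N)%N -> L (coord K N.+1 k) /\ forall i j : 'I_N.+1,
    i = k :> nat -> i = j.+1 :> nat ->
    L (shear (pvar K i ^+ 1) j) /\ L (shear (pvar K i ^+ 2) j).
  move=> kN; have inj a b : (a <= N)%N -> (b <= N)%N ->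
      inord (N - a) = inord (N - b) :> 'I_N.+1 -> a = b.
    move=> aN bN /(congr1 val) /=; rewrite !inordE ?leq_subr // => eqab.
    by rewrite -(subKn aN) eqab subKn.
  have := @chain_closed _ _ _ Lcl _ N inj; rewrite subn0 !inordE // => /(_ LU LV').
  case/(_ (N - k)%N (leq_subr _ _)); rewrite inordE ?leq_subr // subKn // => Lk step.
  split=> // i j ik ij; have jE : inord (N - (N - k).+1) = j.
    by apply: val_inj; rewrite /= inordE ?leq_subr //; lia.
  by move: step; rewrite jE -ik inord_val; apply; lia.
have Lcoord (j : 'I_N.+1) : L (coord K N.+1 j) by have [] := down j (ltn_ord j).
have up (i j : 'I_N.+1) : j = i.+1 :> nat ->
    L (shear (pvar K i ^+ 1) j) /\ L (shear (pvar K i ^+ 2) j).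
  move=> ji; have inj a b : (a <= N)%N -> (b <= N)%N -> inord a = inord b :> 'I_N.+1 -> a = b.
    by move=> aN bN /(congr1 val) /=; rewrite !inordE.
  have := @chain_closed _ _ _ Lcl _ N inj; rewrite inordE // => /(_ (Lcoord ord0) LV'').
  case/(_ i (ltn_ord i)) => _; rewrite -ji !inord_val; apply.
  exact: (ltn_ord j).
have adjacent (i j : 'I_N.+1) : (j == i.+1 :> nat) || (i == j.+1 :> nat) ->
    L (shear (pvar K i ^+ 1) j) /\ L (shear (pvar K i ^+ 2) j).
  case/orP => /eqP; first exact: up.
  by have [_] := down i (ltn_ord i); apply.
(* This is [z_i^a d_k, z_k d_j] = z_i^a d_j. *)
have through a (i k j : 'I_N.+1) : j != i -> L (shear (pvar K i ^+ a) k) ->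
    L (shear (pvar K k ^+ 1) j) -> L (shear (pvar K i ^+ a) j).
  move=> ne_ji Lik Lkj; have := closed_shear_mul Lcl (mderiv_pvarX0 K a ne_ji) Lik Lkj.
  by rewrite mderiv_pvarXx expr0 scale1r mulr1.
have Lx (i j : 'I_N.+1) : i != j -> L (shear (pvar K i ^+ 1) j).
  (* Induction on the distance between [i] and [j]; the intermediate index [k] is the neighbour of
     [j] on the side of [i]. *)
  have [d] := ubnP (maxn i j - minn i j); elim: d i j => // d IH i j dist ne_ij.
  have {}ne_ij : i <> j :> nat by move=> /val_inj; apply/eqP.
  have [nij|far] := boolP ((j == i.+1 :> nat) || (i == j.+1 :> nat)).
    by have [] := adjacent _ _ nij.
  pose k : 'I_N.+1 := inord (if (i < j)%N then j.-1 else j.+1).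
  have kE : k = (if (i < j)%N then j.-1 else j.+1) :> nat.
    by rewrite inordE //; have := ltn_ord i; have := ltn_ord j; case: ifP; lia.
  apply: (through _ _ k); first by apply/eqP => /(congr1 val) /=; lia.
    apply: IH; last by apply/eqP => /(congr1 val) /=; move: kE; case: ifP; lia.
    by move: kE; case: ifP; lia.
  have kj : (j == k.+1 :> nat) || (k == j.+1 :> nat) by move: kE; case: ifP; lia.
  by have [] := adjacent k j kj.
have Lx2 (i j : 'I_N.+1) : i != j -> L (shear (pvar K i ^+ 2) j).
  (* Any neighbour of [i] serves to introduce the square: i + 1, or i - 1 at the last index, which
     exists because N > 0. *)
  move=> ne_ij; pose k : 'I_N.+1 := inord (if (i < N)%N then i.+1 else i.-1).
  have kE : k = (if (i < N)%N then i.+1 else i.-1) :> nat.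
    by rewrite inordE //; have := ltn_ord i; case: ifP; lia.
  have [_ Lik] : L (shear (pvar K i ^+ 1) k) /\ L (shear (pvar K i ^+ 2) k).
    apply: adjacent; have := ltn_ord i; rewrite kE.
    by case: (ltnP i N); lia.
  have [<-//|ne_kj] := eqVneq k j.
  by apply: (through _ _ k); rewrite 1?eq_sym //; exact: Lx.
apply: closed_divergence0 => // i j a ne_ij.
by apply: closed_pow => //; [exact: Lx|exact: Lx2|rewrite eq_sym in ne_ij; exact: Lx].
Qed.

End Assembly.

Theorem theorem10 (R : realType) (n : nat) (hn : (2 <= n)%N) :
  [/\ complete (Uvf R n), complete (V'vf R n), complete (V''vf R n)
    & lie_generated [set Uvf R n; V'vf R n; V''vf R n] =
      lie_generated [set V : polyvf R n | polynomial_flow V]].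
Proof.
have pU := Uvf_polynomial_flow R n.
have pV' := V'vf_polynomial_flow R n.
have pV'' := V''vf_polynomial_flow R n.
split; try exact: polynomial_flow_complete.
apply/seteqP; split=> [V genV L [Lcl flowL]|V genV L [Lcl genL]].
  (* One inclusion holds because the three fields themselves have polynomial flow. *)
  by apply: genV; split=> // W [[->|->]|->]; exact: flowL.
(* For the other, it suffices to place each field with polynomial flow in an arbitrary [L]
   containing the three; its divergence vanishes, so the generation result applies. *)
apply: genV; split=> // W flowW.
case: n hn L Lcl genL W flowW {pU pV' pV'' V} => [//|N] hn L Lcl genL W flowW.
apply: (@divergence0_generated (CC R) N L W) => //.
- by apply: genL; left; left.
- by apply: genL; left; right.
- by apply: genL; right.
exact: polynomial_flow_divergence0.
Qed.
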